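(* For every integer $q\ge 4$, $\lfloor\sqrt{q}\rfloor^3\le M(\overline{3},3,q)\le\left\lfloor\frac{3q^2}{4}\right\rfloor$.
   Context: An $(n,M,q)$ code is a set $\mathcal{C}\subseteq Q^n$ of $M$ distinct codewords, $|Q|=q$. For $\mathcal{C}_0\subseteq\mathcal{C}$, let $\mathcal{C}_0(i)=\{\mathbf{c}(i):\mathbf{c}\in\mathcal{C}_0\}$ and $\mathsf{desc}(\mathcal{C}_0)=\mathcal{C}_0(1)\times\cdots\times\mathcal{C}_0(n)$. $\mathcal{C}$ is a strongly $\overline{t}$-separable code ($\overline{t}$-SSC$(n,M,q)$) if for every $\mathcal{C}_0\subseteq\mathcal{C}$ with $1\le|\mathcal{C}_0|\le t$, $\bigcap_{\mathcal{C}'\in S(\mathcal{C}_0)}\mathcal{C}'=\mathcal{C}_0$, where $S(\mathcal{C}_0)=\{\mathcal{C}'\subseteq\mathcal{C}:\mathsf{desc}(\mathcal{C}')=\mathsf{desc}(\mathcal{C}_0)\}$. $M(\overline{t},n,q)$ denotes the maximum $M$ such that a $\overline{t}$-SSC$(n,M,q)$ exists. *)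

(* Defs.v *)
From mathcomp Require Import all_boot.

Set Implicit Arguments.
Unset Strict Implicit.
Unset Printing Implicit Defensive.

Section StronglySeparable.

Variables (n : nat) (Q : finType).

Definition code := {set {ffun 'I_n -> Q}}.

Implicit Type C : code.

Definition coords (C0 : code) (i : 'I_n) : {set Q} := [set c i | c : {ffun 'I_n -> Q} in C0].

Definition desc (C0 : code) : code :=
  [set x : {ffun 'I_n -> Q} | [forall i, x i \in coords C0 i]].

Definition same_desc C (C0 : code) : {set code} :=
  [set C' : code | (C' \subset C) && (desc C' == desc C0)].

Definition strongly_separable (t : nat) C : bool :=
  [forall C0 : code, (C0 \subset C) && (1 <= #|C0| <= t) ==>
    (\bigcap_(C' in same_desc C C0) C' == C0)].

End StronglySeparable.

(* Strong separability is invariant under relabelling the alphabet, so 'I_q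
   stands for an arbitrary alphabet of size q.  The empty code satisfies the
   condition vacuously, so the maximum is over a nonempty family and is
   attained. *)
Definition max_SSC (t n q : nat) : nat :=
  \max_(C : code n 'I_q | strongly_separable t C) #|C|.

(* Main.v *)
(** Strong separability says that each word [c] of a small [C0] has a coordinate
in which no other codeword of [desc C0] agrees with it.

Lower bound: send a word [t] over an alphabet of size [k = Nat.sqrt q] to
[((t0,t1),(t1,t2),(t2,t0))].  If [c] violated the condition in [{c, c2, c3}],
then for every ordered pair of positions one of [c2], [c3] would agree with [c]
in the first and differ in the second; but the three subsets of [{c2, c3}] of
words differing from [c] in a given position would then form an antichain of
size 3 among the subsets of a 2-element set.

Upper bound: discard the words that are alone with their symbol in some
coordinate.  Two of the remaining words agree in at most one coordinate, so they
form a properly edge-coloured bipartite graph: coordinates 0 and 1 are the end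
points, coordinate 2 is the colour.  Separability makes every 4-cycle rainbow, so
two rows have at most [q/2] common neighbours, their degrees add up to at most
[3q/2], and averaging gives at most [3q^2/4] edges.  If [u_i]
words are discarded in coordinate [i], they use up [u_i] of its symbols, and
[u0 + u1 + u2 + (q - u0)(2(q - u1) + (q - u2))/4 <= 3q^2/4] for [4 <= q]. *)

Require Import Defs.
From mathcomp Require Import all_boot.
From mathcomp Require Import zify.

Set Implicit Arguments.
Unset Strict Implicit.
Unset Printing Implicit Defensive.

(** * Strong separability as a condition on single words *)

Section Characterization.

Variables (n : nat) (Q : finType).
Implicit Types (C D : code n Q) (c x : {ffun 'I_n -> Q}).

Lemma descP D x :
  reflect (forall i, exists2 c, c \in D & x i = c i) (x \in desc D).
Proof.
rewrite inE; apply: (iffP forallP) => h i; first exact/imsetP.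
by apply/imsetP; apply: h.
Qed.

Lemma sub_desc D : D \subset desc D.
Proof. by apply/subsetP => x Dx; apply/descP => i; exists x. Qed.

(** If no coordinate singles out [c], each symbol of [c] is also supplied by another codeword of
    [desc D], so [(C :&: desc D) :\ c] belongs to [same_desc C D] and omits [c]. Conversely, any
    member of [same_desc C D] has a word matching [c i], which can only be [c]. *)
Lemma strongly_separableP t C :
  reflect (forall D c, D \subset C -> #|D| <= t -> c \in D ->
             exists i, forall x, x \in C -> x \in desc D -> x i = c i -> x = c)
          (strongly_separable t C).
Proof.
apply: (iffP forallP) => [sepC D c sDC leDt Dc | sepC D].
  have D1 : 0 < #|D| by apply/card_gt0P; exists c.
  have /eqP capD := implyP (sepC D) (introT and3P (And3 sDC D1 leDt)).
  suff /existsP[i /forallP hi] :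
      [exists i, forall x, [&& x \in C, x \in desc D & x i == c i] ==> (x == c)].
    exists i => x Cx Dx /eqP xi; apply/eqP.
    by apply: (implyP (hi x)); rewrite Cx Dx.
  apply: contraT => /existsPn noi.
  pose D' := (C :&: desc D) :\ c.
  suff D'in : D' \in same_desc C D.
    by move: Dc; rewrite -capD => /bigcapP/(_ _ D'in); rewrite !inE eqxx.
  rewrite inE; apply/andP; split.
    by apply/subsetP => x /setD1P[_ /setIP[]].
  have coordsE : coords D' =1 coords D.
    move=> i; apply/setP => s; apply/imsetP/imsetP => -[y yin ->].
      by move: yin => /setD1P[_ /setIP[_ /descP/(_ i)]].
    have [-> | yc] := eqVneq y c.
      have /forallPn[x] := noi i.
      rewrite negb_imply => /andP[/and3P[Cx Dx /eqP <-] xc].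
      by exists x => //; rewrite in_setD1 xc in_setI Cx.
    exists y => //.
    by rewrite in_setD1 yc in_setI (subsetP sDC) //= (subsetP (sub_desc D)).
  apply/eqP/setP => x; rewrite !inE.
  by apply: eq_forallb => i; rewrite coordsE.
apply/implyP => /and3P[sDC _ leDt].
rewrite eqEsubset; apply/andP; split.
  by apply: bigcap_inf; rewrite inE sDC eqxx.
apply/subsetP => c Dc; apply/bigcapP => D'.
rewrite inE => /andP[sD'C /eqP descE].
have [i hi] := sepC D c sDC leDt Dc.
have /descP/(_ i)[x D'x cx] : c \in desc D'.
  by rewrite descE (subsetP (sub_desc D)).
rewrite -(hi x) ?(subsetP sD'C) //.
by rewrite -descE (subsetP (sub_desc D')).
Qed.

End Characterization.

(** Smaller sets are padded by repeating [c], so that all sizes are treated as one triple. *)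
Lemma card_le3_sub (T : finType) (D : {set T}) c : c \in D -> #|D| <= 3 ->
  exists c2 c3, [/\ c2 \in D, c3 \in D & D \subset [set c; c2; c3]].
Proof.
move=> Dc; rewrite (cardsD1 c) Dc ltnS => leD.
have memE x : (x \in enum (D :\ c)) = (x != c) && (x \in D).
  by rewrite mem_enum in_setD1.
move: leD; rewrite cardE.
case: (enum _) memE => [|x [|y [|//]]] memE _.
- exists c, c; split=> //; apply/subsetP => z Dz; rewrite !inE.
  by have := memE z; rewrite Dz in_nil andbT; case: eqP.
- have := memE x; rewrite !inE eqxx => /esym/andP[_ Dx].
  exists c, x; split=> //; apply/subsetP => z Dz.
  by have := memE z; rewrite Dz !inE andbT; do 2!case: eqP.
have := memE x; have := memE y; rewrite !inE !eqxx orbT.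
move=> /esym/andP[_ Dy] /esym/andP[_ Dx].
exists x, y; split=> //; apply/subsetP => z Dz.
by have := memE z; rewrite Dz !inE andbT; do 3!case: eqP.
Qed.

(** * Lower bound: the code of cyclic pairs *)

Section LowerBound.

Variables (K Q : finType) (f : K * K -> Q).
Hypothesis f_inj : injective f.

Definition edge_word (t : {ffun 'I_3 -> K}) : {ffun 'I_3 -> Q} :=
  [ffun i => f (t i, t (ordS i))].

Lemma edge_word_eq s t i :
  edge_word s i = edge_word t i -> s i = t i /\ s (ordS i) = t (ordS i).
Proof. by rewrite !ffunE => /f_inj[]. Qed.

Lemma edge_word_inj : injective edge_word.
Proof.
move=> s t st; apply/ffunP => i.
by have [] : s i = t i /\ s (ordS i) = t (ordS i) by apply: edge_word_eq; rewrite st.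
Qed.

Lemma ordS3K (i : 'I_3) : ordS (ordS (ordS i)) = i.
Proof. by apply: val_inj; case: i => [[|[|[]]]]. Qed.

Lemma ord3_split (i j : 'I_3) : [|| j == i, j == ordS i | j == ordS (ordS i)].
Proof. by case: i j => [[|[|[|//]]] ?] [[|[|[|//]]] ?]. Qed.

Lemma edge_code_separable : strongly_separable 3 [set edge_word t | t in setT].
Proof.
apply/strongly_separableP => D c sDC leD Dc.
have [c2 [c3 [Dc2 Dc3 /subsetP sD]]] := card_le3_sub Dc leD.
have inC x : x \in D -> exists t, x = edge_word t.
  by move=> /(subsetP sDC)/imsetP[t _ ->]; exists t.
have [t ct] := inC _ Dc; have [t2 ct2] := inC _ Dc2; have [t3 ct3] := inC _ Dc3.
pose sep i := [forall x, [&& x \in [set edge_word t | t in setT],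
                             x \in desc D & x i == c i] ==> (x == c)].
case: (boolP [exists i, sep i]) => [/existsP[i /forallP hi]|/existsPn nosep].
  exists i => x Cx Dx /eqP xi; apply/eqP.
  by apply: (implyP (hi x)); rewrite Cx Dx.
pose diff p r (u : {ffun 'I_3 -> K}) := (u p == t p) && (u r != t r).
(* As [i] varies, [anti i] covers all six ordered pairs of positions; no truth values for the
   comparisons of [t2] and [t3] with [t] satisfy them all. *)
suff anti i : (diff (ordS i) (ordS (ordS i)) t2 || diff (ordS i) (ordS (ordS i)) t3)
    && (diff i (ordS (ordS i)) t2 || diff i (ordS (ordS i)) t3).
  pose o := ord0 : 'I_3.
  have := anti (ordS (ordS o)); have := anti (ordS o); have := anti o.
  rewrite /diff !ordS3K.
  by do 3!(case: (t2 _ == _); case: (t3 _ == _)).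
have /forallPn[x] := nosep i; rewrite negb_imply.
move=> /andP[/and3P[/imsetP[s _ {x}->] /descP sdesc /eqP]].
rewrite ct => /edge_word_eq[s0 s1] sc.
have s2 : s (ordS (ordS i)) != t (ordS (ordS i)).
  apply: contraNneq sc => s2; apply/eqP; congr edge_word; apply/ffunP => j.
  by case/or3P: (ord3_split i j) => /eqP ->.
(* Some word of [D] supplies coordinate [j] of [edge_word s]; it is not [c], since [s] differs from
   [t] at [r]. *)
have key j p r : s p = t p -> s r != t r ->
    (forall u, edge_word s j = edge_word u j -> s p = u p /\ s r = u r) ->
    diff p r t2 || diff p r t3.
  move=> sp sr hu; have [x Dx] := sdesc j; have := sD _ Dx.
  rewrite !inE ct ct2 ct3 -orbA => /or3P[] /eqP -> /hu [up ur].
  - by rewrite ur eqxx in sr.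
  - by rewrite /diff -up -ur sp eqxx sr.
  - by rewrite /diff -up -ur sp eqxx sr orbT.
apply/andP; split.
  by apply: (key (ordS i)) => // u /edge_word_eq[].
by apply: (key (ordS (ordS i))) => // u /edge_word_eq[]; rewrite ordS3K.
Qed.

Lemma card_edge_code : #|[set edge_word t | t in setT]| = #|K| ^ 3.
Proof. by rewrite card_imset ?cardsT ?card_ffun ?card_ord //; exact: edge_word_inj. Qed.

End LowerBound.

Lemma max_SSC_ge_cube k q : k * k <= q -> k ^ 3 <= max_SSC 3 3 q.
Proof.
move=> lekq.
have cardE : #|{: 'I_k * 'I_k}| <= q by rewrite card_prod card_ord.
pose f (p : 'I_k * 'I_k) := widen_ord cardE (enum_rank p).
have f_inj : injective f by move=> x y [/val_inj/enum_rank_inj].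
have := card_edge_code f_inj; rewrite card_ord => <-.
by apply: leq_bigmax_cond; apply: edge_code_separable.
Qed.

(** Sum the hypothesis over ordered pairs of distinct elements: each [d a] occurs [2 * (#|A| - 1)]
    times, and the positive factor [#|A| - 1] cancels. *)
Lemma sum_le_of_pairs (T : finType) (A : {set T}) (d : T -> nat) B :
    1 < #|A| -> {in A &, forall a b, a != b -> 2 * (d a + d b) <= B} ->
  4 * (\sum_(a in A) d a) <= #|A| * B.
Proof.
move=> A2 hd; set m := #|A| in A2 *; set F := \sum_(a in A) d a.
have row a : a \in A -> 2 * (m - 2) * d a + 2 * F <= (m - 1) * B.
  move=> Aa.
  have cardA : #|A :\ a| = m - 1 by rewrite /m (cardsD1 a A) Aa; lia.
  have FE : F = d a + \sum_(b in A :\ a) d b by rewrite /F (big_setD1 a).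
  have : \sum_(b in A :\ a) 2 * (d a + d b) <= \sum_(b in A :\ a) B.
    by apply: leq_sum => b /setD1P[ba Ab]; apply: hd => //; rewrite eq_sym.
  rewrite -big_distrr big_split /= !sum_nat_const cardA.
  nia.
have : \sum_(a in A) (2 * (m - 2) * d a + 2 * F) <= \sum_(a in A) (m - 1) * B.
  exact: leq_sum.
rewrite big_split /= -big_distrr /= !sum_nat_const -/m -/F.
nia.
Qed.

(** * Upper bound: the edge-coloured graph of shared words *)

Section UpperBound.

Variables (Q : finType) (C : code 3 Q).
Hypothesis sepC : strongly_separable 3 C.
Implicit Types c x y z : {ffun 'I_3 -> Q}.

Definition lonely i := [set c in C | [forall x in C, (x i == c i) ==> (x == c)]].

Definition shared := C :\: \bigcup_i lonely i.

Lemma shared_witness c i : c \in shared -> exists z, [/\ z \in C, z i = c i & z != c].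
Proof.
move=> /setDP[Cc /bigcupP nl].
have : c \notin lonely i by apply/negP => lc; apply: nl; exists i.
rewrite inE Cc => /forallPn[z]; rewrite !negb_imply => /and3P[Cz /eqP zi zc].
by exists z.
Qed.

Lemma shared_sub c : c \in shared -> c \in C.
Proof. by case/setDP. Qed.

(** The form in which separability is used below; repetitions among [c], [x], [y] are allowed, which
    spares distinctness proofs. *)
Lemma no_cover c x y : c \in C -> x \in C -> y \in C ->
  ~ (forall i, exists z, [/\ z \in C, z \in desc [set c; x; y], z i = c i & z != c]).
Proof.
move=> Cc Cx Cy bad.
have /strongly_separableP/(_ [set c; x; y] c)[||| i hi] := sepC.
- by apply/subsetP => z; rewrite !inE -orbA => /or3P[] /eqP ->.
- have := (leq_card_setU [set c; x] [set y]).1.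
  by rewrite cards1 cards2 => /leq_trans; apply; case: (_ != _).
- by rewrite !inE eqxx.
by have [z [Cz Dz zi /eqP]] := bad i; apply; apply: hi.
Qed.

(** Otherwise [x] covers [c] outside [i] and a word sharing the symbol [c i] covers it at [i]. *)
Lemma shared_agree2 c x i : c \in shared -> x \in C ->
  (forall j, j != i -> x j = c j) -> x = c.
Proof.
move=> Rc Cx xc; apply/eqP; apply: contraT => nxc.
have [z [Cz zi nzc]] := shared_witness i Rc.
case: (no_cover (shared_sub Rc) Cx Cz) => j.
have in_desc w : w \in [set c; x; z] -> w \in desc [set c; x; z].
  exact/subsetP/sub_desc.
have [-> | ji] := eqVneq j i.
  by exists z; split=> //; rewrite in_desc // !inE eqxx !orbT.
by exists x; split=> //; [rewrite in_desc // !inE eqxx orbT | exact: xc].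
Qed.

Let i0 : 'I_3 := @Ordinal 3 0 isT.
Let i1 : 'I_3 := @Ordinal 3 1 isT.
Let i2 : 'I_3 := @Ordinal 3 2 isT.

Lemma ord3P (P : 'I_3 -> Prop) : P i0 -> P i1 -> P i2 -> forall i, P i.
Proof.
move=> P0 P1 P2 [[|[|[|//]]] lti].
- by rewrite (_ : Ordinal _ = i0) //; apply: val_inj.
- by rewrite (_ : Ordinal _ = i1) //; apply: val_inj.
- by rewrite (_ : Ordinal _ = i2) //; apply: val_inj.
Qed.

Lemma shared_eq01 c x : c \in shared -> x \in C ->
  x i0 = c i0 -> x i1 = c i1 -> x = c.
Proof. by move=> Rc Cx e0 e1; apply: (@shared_agree2 _ _ i2) => //; apply: ord3P. Qed.

Lemma shared_eq02 c x : c \in shared -> x \in C ->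
  x i0 = c i0 -> x i2 = c i2 -> x = c.
Proof. by move=> Rc Cx e0 e1; apply: (@shared_agree2 _ _ i1) => //; apply: ord3P. Qed.

Lemma shared_eq12 c x : c \in shared -> x \in C ->
  x i1 = c i1 -> x i2 = c i2 -> x = c.
Proof. by move=> Rc Cx e0 e1; apply: (@shared_agree2 _ _ i0) => //; apply: ord3P. Qed.

(** Here [c] and [z] are opposite edges of the 4-cycle [c], [x], [z], [y]. If they differed, [x],
    [y], [z] would cover [c] in coordinates 0, 1, 2; [z] lies in [desc [set c; x; y]], taking its
    symbols from [y], [x], [c]. *)
Lemma shared_rainbow c z x y : c \in shared -> z \in C -> x \in C -> y \in C ->
  z i2 = c i2 -> x i0 = c i0 -> x i1 = z i1 -> y i0 = z i0 -> y i1 = c i1 ->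
  z = c.
Proof.
move=> Rc Cz Cx Cy z2 x0 x1 y0 y1; apply/eqP; apply: contraT => nzc.
case: (no_cover (shared_sub Rc) Cx Cy).
have in_desc w : w \in [set c; x; y] -> w \in desc [set c; x; y].
  exact/subsetP/sub_desc.
apply: ord3P.
- exists x; split=> //; first by rewrite in_desc // !inE eqxx orbT.
  apply: contraNneq nzc => xc; apply/eqP/shared_eq12 => //.
  by rewrite -x1 xc.
- exists y; split=> //; first by rewrite in_desc // !inE eqxx !orbT.
  apply: contraNneq nzc => yc; apply/eqP/shared_eq02 => //.
  by rewrite -y0 yc.
exists z; split=> //; apply/descP; apply: ord3P.
- by exists y; rewrite ?inE ?eqxx ?orbT.
- by exists x; rewrite ?inE ?eqxx ?orbT.
- by exists c; rewrite ?inE ?eqxx.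
Qed.

Definition row a := [set c in shared | c i0 == a].

Definition nbr a : {set Q} := [set c i1 | c : {ffun 'I_3 -> Q} in row a].

Lemma card_nbr a : #|nbr a| = #|row a|.
Proof.
apply: card_in_imset => c x /setIdP[Rc /eqP c0] /setIdP[Rx /eqP x0] e1.
by apply: shared_eq01 => //; [exact: shared_sub | rewrite c0 x0].
Qed.

(** The edges from [a] and [b] into [S] number at least [2 * #|S|] and have pairwise distinct
    colours. *)
Lemma codegree_le a b : a != b -> 2 * #|nbr a :&: nbr b| <= #|coords shared i2|.
Proof.
move=> ab; set S := _ :&: _.
pose W d := [set c in row d | c i1 \in S].
have cardW d : S \subset nbr d -> #|S| <= #|W d|.
  move=> /subsetP sS.
  have : S \subset [set c i1 | c : {ffun 'I_3 -> Q} in W d].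
    apply/subsetP => s Ss; have /imsetP[c rc sE] := sS _ Ss.
    by apply/imsetP; exists c; rewrite // inE rc -sE.
  by move=> /subset_leq_card/leq_trans; apply; apply: leq_imset_card.
have disjW : [disjoint W a & W b].
  rewrite -setI_eq0; apply/eqP/setP => c; rewrite !inE.
  by apply/negP => /andP[/andP[/andP[_ /eqP ->]]]; rewrite (negbTE ab) andbF.
have colour_inj : {in W a :|: W b &, injective (fun c : {ffun 'I_3 -> Q} => c i2)}.
  have WP d c : c \in W d -> [/\ c \in shared, c i0 = d & c i1 \in S].
    by move=> /setIdP[/setIdP[Rc /eqP c0]].
  have same d : {in W d &, forall c z, c i2 = z i2 -> c = z}.
    move=> c z /WP[/shared_sub Cc c0 _] /WP[Rz z0 _] e2.
    by apply: shared_eq02; rewrite ?c0.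
  (* The case [c i1 = z i1] needs no separate treatment: [shared_rainbow] admits degenerate
     cycles. *)
  have cross : {in W a & W b, forall c z, c i2 = z i2 -> c = z}.
    move=> c z /WP[Rc c0 Sc] /WP[Rz z0 Sz] e2.
    have /setIP[/imsetP[x /setIdP[Rx /eqP x0] x1] _] := Sz.
    have /setIP[_ /imsetP[y /setIdP[Ry /eqP y0] y1]] := Sc.
    by apply/esym/(@shared_rainbow c z x y); rewrite ?shared_sub ?x0 ?y0.
  move=> c z /setUP[] Wc /setUP[] Wz e2.
  - exact: same Wc Wz e2.
  - exact: cross Wc Wz e2.
  - by apply/esym/cross.
  - exact: same Wc Wz e2.
have : #|W a :|: W b| <= #|coords shared i2|.
  rewrite -(card_in_imset colour_inj); apply: subset_leq_card.
  apply/subsetP => _ /imsetP[c Wc ->]; apply: imset_f.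
  by move: Wc => /setUP[] /setIdP[/setIdP[]].
have := (leq_card_setU (W a) (W b)).2; rewrite disjW => /eqP ->.
have := cardW a (subsetIl _ _); have := cardW b (subsetIr _ _); lia.
Qed.

Lemma degree_pair_le a b : a != b ->
  2 * (#|row a| + #|row b|) <= 2 * #|coords shared i1| + #|coords shared i2|.
Proof.
move=> /codegree_le; rewrite -!card_nbr -cardsUI.
suff /subset_leq_card : nbr a :|: nbr b \subset coords shared i1 by lia.
by apply/subsetP => s /setUP[] /imsetP[c /setIdP[Rc _] ->]; apply: imset_f.
Qed.

Lemma card_shared : #|shared| = \sum_(a in coords shared i0) #|row a|.
Proof.
rewrite -sum1_card (partition_big (fun c => c i0) (mem (coords shared i0))) /=.
  by apply: eq_bigr => a _; rewrite -sum1_card; apply: eq_bigl => c; rewrite [RHS]in_set.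
by move=> c Rc; apply: imset_f.
Qed.

(** Serves the case of at most one row, where there are no pairs to average over. *)
Lemma card_shared_le_mul : #|shared| <= #|coords shared i0| * #|coords shared i1|.
Proof.
rewrite -cardsX.
have pair_inj : {in shared &, injective (fun c : {ffun 'I_3 -> Q} => (c i0, c i1))}.
  by move=> c z Rc Rz [e0 e1]; apply: shared_eq01 => //; apply: shared_sub.
rewrite -(card_in_imset pair_inj); apply: subset_leq_card.
by apply/subsetP => _ /imsetP[c Rc ->]; apply/setXP; split; apply: imset_f.
Qed.

(** Lonely words have distinct symbols at [i], none of them used there by a shared word. *)
Lemma card_lonely i : #|lonely i| + #|coords shared i| <= #|Q|.
Proof.
have lonelyP c x : c \in lonely i -> x \in C -> x i = c i -> x = c.
  move=> /setIdP[_ /forall_inP h] Cx /eqP xi; apply/eqP.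
  exact: (implyP (h x Cx)).
have val_inj_lonely : {in lonely i &, injective (fun c : {ffun 'I_3 -> Q} => c i)}.
  by move=> c x lc /setIdP[Cx _] e; apply/esym/lonelyP.
rewrite -(card_in_imset val_inj_lonely) -cardsUI addnC.
rewrite (_ : _ :&: _ = set0) ?cards0 ?max_card //.
apply/setP => s; rewrite !inE; apply/negP => /andP[/imsetP[c lc ->]].
move=> /imsetP[r Rr e]; have Er := lonelyP c r lc (shared_sub Rr) (esym e).
by have /setDP[_ /bigcupP[]] := Rr; exists i; rewrite ?Er.
Qed.

Lemma card_code_le : #|C| <= #|lonely i0| + #|lonely i1| + #|lonely i2| + #|shared|.
Proof.
have sC : C \subset lonely i0 :|: lonely i1 :|: lonely i2 :|: shared.
  apply/subsetP => c Cc; rewrite !in_setU.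
  have [] := boolP (c \in shared); first by rewrite orbT.
  rewrite in_setD Cc andbT negbK => /bigcupP[i _ li]; rewrite orbF.
  by elim/ord3P: i li => ->; rewrite ?orbT.
have := subset_leq_card sC.
have := (leq_card_setU (lonely i0 :|: lonely i1 :|: lonely i2) shared).1.
have := (leq_card_setU (lonely i0 :|: lonely i1) (lonely i2)).1.
have := (leq_card_setU (lonely i0) (lonely i1)).1.
lia.
Qed.

Lemma separable_card_le : 4 <= #|Q| -> 4 * #|C| <= 3 * #|Q| ^ 2.
Proof.
move=> hq; have := card_code_le.
have := card_lonely i0; have := card_lonely i1; have := card_lonely i2.
have := card_shared_le_mul.
have : 1 < #|coords shared i0| -> 4 * #|shared| <=
    #|coords shared i0| * (2 * #|coords shared i1| + #|coords shared i2|).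
  move=> A2; rewrite card_shared; apply: sum_le_of_pairs => // a b _ _.
  exact: degree_pair_le.
move: #|lonely i0| #|lonely i1| #|lonely i2| => u0 u1 u2.
move: #|coords shared i0| #|coords shared i1| #|coords shared i2| => a0 a1 a2.
move: #|shared| #|C| #|Q| hq => r m q hq h4 h2 l2 l1 l0 hm.
have q2 : 4 * q <= q ^ 2 by rewrite expnS expn1 leq_mul2r hq orbT.
(* Here [r <= a1], so [m <= 3 * q], and [4 <= q] suffices. *)
have [a0_le1 | a0_gt1] := leqP a0 1.
  have : a0 * a1 <= 1 * a1 by rewrite leq_mul2r a0_le1 orbT.
  lia.
have {}h4 := h4 a0_gt1.
have [small | big] := leqP (2 * a1 + a2) 4.
  have : a0 * (2 * a1 + a2) <= a0 * 4 by rewrite leq_mul2l small orbT.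
  lia.
(* Substituting [u_j <= q - a_j] leaves a bound in which [a0] has coefficient [s]; once [a0] is
   raised to [q], [a1] and [a2] have coefficients [2 * p + 4] and [p]. All are nonnegative, so each
   [a_j] can be raised to [q] in turn, giving [3 * q ^ 2]. *)
have [s sE] : exists s, 2 * a1 + a2 = s + 4 by exists (2 * a1 + a2 - 4); lia.
have [p pE] : exists p, q = p + 4 by exists (q - 4); lia.
rewrite sE in h4.
have a0s : a0 * s <= q * s by rewrite leq_mul2r; lia.
have a1p : a1 * (2 * p + 4) <= q * (2 * p + 4) by rewrite leq_mul2r; lia.
have a2p : a2 * p <= q * p by rewrite leq_mul2r; lia.
have qs : q * (2 * a1 + a2) = q * (s + 4) by rewrite sE.
subst q; lia.
Qed.

End UpperBound.

Theorem theorem6 (q : nat) (hq : 4 <= q) :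
  (Nat.sqrt q) ^ 3 <= max_SSC 3 3 q <= (3 * q ^ 2) %/ 4.
Proof.
apply/andP; split.
  apply: max_SSC_ge_cube; apply/leP.
  exact: (PeanoNat.Nat.sqrt_spec q (PeanoNat.Nat.le_0_l q)).1.
apply/bigmax_leqP => C sepC; rewrite leq_divRL // mulnC.
by have := separable_card_le sepC; rewrite card_ord; apply.
Qed.
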